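(* Let $\Bbbk$ be a field, let $n,h$ be integers with $1\le h<n$, let $R=\Bbbk[x_1,\dots,x_n]$, and let $$I_{n,h}=\bigcap_{1\le i_1<\dots<i_h\le n}(x_{i_1},\dots,x_{i_h})$$ be the defining ideal of the codimension $h$ monomial star configuration. Then $$\operatorname{svd}(I_{n,h})=\operatorname{lcm}(1,2,\ldots,h).$$
   Context: For an ideal $I$ of a Noetherian commutative ring $R$ and $m\ge 1$, the $m$-th symbolic power of $I$ is $I^{(m)}=\bigcap_{\mathfrak p\in \operatorname{Ass}(I)}(I^mR_{\mathfrak p}\cap R)$, where $\operatorname{Ass}(I)$ is the set of associated primes of $R/I$, and $I^mR_{\mathfrak p}\cap R$ denotes the preimage of $I^mR_{\mathfrak p}$ under $R\to R_{\mathfrak p}$. The standard Veronese degree of $I$ is $\operatorname{svd}(I)=\inf\{d\ge 1 \mid I^{(dk)}=(I^{(d)})^k \text{ for all } k\ge 1\}$. *)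

(* Defs.v *)
From HB Require Import structures.
From mathcomp Require Import all_boot all_order all_algebra.
From mathcomp Require Import boolp classical_sets.
From mathcomp Require Import mpoly.

Set Implicit Arguments.
Unset Strict Implicit.
Unset Printing Implicit Defensive.

Import GRing.Theory.
Local Open Scope ring_scope.
Local Open Scope classical_set_scope.

(* [A] is meant to be (the underlying set of) a subring of [S]; [A = setT]
   gives the ideals of [S] itself.  Ideals are not required to be proper. *)
Definition ideal_of (S : comNzRingType) (A J : set S) : Prop :=
  [/\ J `<=` A, J 0, forall x y, J x -> J y -> J (x + y)
    & forall a x, A a -> J x -> J (a * x)].

Definition ideal_gen (S : comNzRingType) (A G : set S) : set S :=
  smallest (@ideal_of S A) G.

Definition ideal_mul (R : comNzRingType) (I J : set R) : set R :=
  ideal_gen setT [set z | exists x y, [/\ I x, J y & z = x * y]].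

Definition ideal_pow (R : comNzRingType) (I : set R) (m : nat) : set R :=
  iter m (ideal_mul I) setT.

(* [idealr_closed] includes properness (1 does not belong to [p]). *)
Definition prime_ideal (R : comNzRingType) (p : set R) : Prop :=
  idealr_closed (mem p) /\ prime_idealr_closed (mem p).

(* Associated primes of the module R / I: the primes which are the annihilator
   of the class of some a in R. *)
Definition Ass (R : comNzRingType) (I : set R) : set (set R) :=
  [set p | prime_ideal p /\ exists a : R, p = [set r | I (r * a)]].

(* For a domain R, the localization R_p is realized inside Frac(R), where the
   canonical map R -> R_p is [tofrac]. *)
Definition localization (R : idomainType) (p : set R) : set {fraction R} :=
  [set q | exists a s : R, ~ p s /\ q = tofrac a / tofrac s].

Definition ideal_ext (R : idomainType) (p I : set R) : set {fraction R} :=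
  ideal_gen (localization p) (@tofrac R @` I).

Definition symbolic_pow (R : idomainType) (I : set R) (m : nat) : set R :=
  \bigcap_(p in Ass I) (@tofrac R @^-1` ideal_ext p (ideal_pow I m)).

Definition svd_set (R : idomainType) (I : set R) (d : nat) : Prop :=
  (1 <= d)%N /\
  forall k, (1 <= k)%N ->
    symbolic_pow I (d * k) = ideal_pow (symbolic_pow I d) k.

Lemma svd_exists (R : idomainType) (I : set R) :
  (exists d, svd_set I d) -> exists d, `[< svd_set I d >].
Proof. by case=> d Id; exists d; apply/asboolP. Qed.

(* The infimum in the naturals extended by +oo: [None] stands for +oo, the
   infimum of the empty set. *)
Definition svd (R : idomainType) (I : set R) : option nat :=
  match pselect (exists d, svd_set I d) with
  | left ex => Some (ex_minn (svd_exists ex))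
  | right _ => None
  end.

(* The index sets i_1 < ... < i_h are the subsets of cardinality h. *)
Definition star_ideal (k : fieldType) (n h : nat) : set {mpoly k[n]} :=
  \bigcap_(A in [set A : {set 'I_n} | #|A| = h])
    ideal_gen setT [set 'X_i | i in [set i | i \in A]].

(* Main.v *)
Require Import Defs.
From mathcomp Require Import all_boot all_order all_algebra.
From mathcomp Require Import boolp classical_sets.
From mathcomp Require Import mpoly.
From mathcomp Require Import zify ring.

(* The symbolic power [I^(m)] is spanned by the monomials whose [h] smallest
   exponents sum to at least [m], so the theorem is about exponent vectors.
   If [d] is admissible and [1 <= j <= h], a product of [n - h + j] variables
   raised to the power [d] lies in [I^(dj)]; in any factorization into [j]
   monomials of [I^(d)] each factor must be a power [e] of that same product,
   whence [d = j e].  Conversely, let [L = lcm(1, ..., h)] and let [u] be an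
   exponent vector in [I^(L(k+1))], with [k >= 1].  Truncating [u] at its
   [h]-th smallest exponent [q] does not change its weight [W], and a summand
   in [I^(L)] can be split off as soon as some cutting level [p] satisfies two
   inequalities on the concave function [p |-> sum_i min(p, u_i)].  Writing
   [W = q s + r] with [r < q], one of [p = L / (s + 1)] and [p = L / s] works. *)

Set Implicit Arguments.
Unset Strict Implicit.
Unset Printing Implicit Defensive.

Import GRing.Theory.

(** * Exponent vectors and cutting levels *)

Section StarExponents.
Variable n : nat.
Implicit Types (A : {set 'I_n}) (u v : 'X_{1..n}).

Definition wt A u := \sum_(i in A) u i.

Definition starexp h m u : Prop := forall A, #|A| = h -> m <= wt A u.

Lemma wtD A u v : wt A (u + v)%MM = wt A u + wt A v.
Proof. by rewrite /wt -big_split; apply: eq_bigr => i _; rewrite mnmDE. Qed.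

Lemma set_between (T : finType) (S U : {set T}) m :
  S \subset U -> #|S| <= m <= #|U| ->
  exists A : {set T}, [/\ S \subset A, A \subset U & #|A| = m].
Proof.
move=> sSU /andP[Sm mU].
have [k mE] : exists k, m = #|S| + k by exists (m - #|S|); rewrite subnKC.
elim: k => [|k IHk] in m Sm mU mE *.
  by exists S; split=> //; rewrite mE addn0.
have [||A [SA AU cA]] := IHk (#|S| + k) _ _ erefl; [lia|lia|].
have : A \proper U by rewrite properEcard AU cA; lia.
case/properP=> _ [x xU xA].
exists (x |: A); split; first by rewrite finset.subsetU // SA orbT.
  by rewrite finset.subUset finset.sub1set xU.
by rewrite finset.cardsU1 xA cA; lia.
Qed.

(** While the sum falls short of [N], some entry lies below its upper bound and can grow by one. *)
Lemma interpolate (lo hi : 'I_n -> nat) (N : nat) :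
  (forall i, lo i <= hi i) -> \sum_i lo i <= N <= \sum_i hi i ->
  exists b : 'I_n -> nat, (forall i, lo i <= b i <= hi i) /\ \sum_i b i = N.
Proof.
move=> lohi /andP[loN Nhi].
have [k NE] : exists k, N = \sum_i lo i + k.
  by exists (N - \sum_i lo i); rewrite subnKC.
elim: k => [|k IHk] in N loN Nhi NE *.
  by exists lo; split=> [i|]; rewrite ?leqnn ?lohi // NE addn0.
have [||b [bP bE]] := IHk (\sum_i lo i + k) _ _ erefl; [lia|lia|].
have [x bx] : exists x, b x < hi x.
  apply/existsP; apply: contraLR Nhi; rewrite negb_exists => /forallP hib.
  have : \sum_i hi i <= \sum_i b i by apply: leq_sum => i _; have := hib i; lia.
  by lia.
exists (fun i => b i + (i == x)); split=> [i|].
  case: eqP => [->|_]; last by rewrite addn0.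
  by rewrite addn1 bx andbT leqW //; case/andP: (bP x).
by rewrite big_split /= bE -big_mkcond big_pred1_eq addn1 NE addnS.
Qed.

Lemma sum_notin A q : \sum_(i | i \notin A) q = (n - #|A|) * q.
Proof.
rewrite (eq_bigl (mem (~: A))) => [|i]; last by rewrite /= inE.
by rewrite sum_nat_const cardsCs finset.setCK card_ord.
Qed.

Section Truncation.
Variables (h : nat) (u : 'X_{1..n}).
Let c := n - h.
Let F q := \sum_i minn q (u i).

(** In [F q], an index of [A] contributes at most its exponent, and each of the [n - h] others at
    most [q]. *)
Lemma sum_min_starexp q m : h <= n -> c * q + m <= F q -> starexp h m u.
Proof.
move=> hn Fq A cA; suff : F q <= wt A u + c * q by lia.
rewrite /F (bigID (mem A)) /= leq_add //.
  by apply: leq_sum => i _; apply: geq_minr.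
rewrite /c -cA -sum_notin.
by apply: leq_sum => i _; apply: geq_minl.
Qed.

(* The witness [q] is the [h]-th smallest exponent. *)
Lemma starexp_sum_min m : 0 < h <= n -> starexp h m u ->
  exists q, c * q + m <= F q /\ (c + 1) * q <= F q.
Proof.
move=> /andP[h0 hn] um.
(* The witness will be the least level that at most [n - h] exponents exceed. *)
have exq : exists q, #|[set i | q < u i]| <= c.
  exists (\sum_i u i); rewrite (_ : [set i | _] = finset.set0) ?cards0 //.
  by apply/setP => i; rewrite !inE (bigD1 i) //=; lia.
case: (ex_minnP exq) => q qc qmin; exists q.
have cS : #|[set i | u i < q]| < h.
  case: q qmin {qc} => [|q] qmin.
    by rewrite (_ : [set i | _] = finset.set0) ?cards0 //; apply/setP => i; rewrite !inE.
  rewrite (_ : [set i | _] = ~: [set i | q < u i]); last first.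
    by apply/setP => i; rewrite !inE; lia.
  have := cardsC [set i | q < u i]; rewrite card_ord => nE.
  have : ~~ (#|[set i | q < u i]| <= c) by apply/negP => /qmin; lia.
  rewrite /c in qmin *; lia.
split; last first.
  have := cardsC [set i | u i < q]; rewrite card_ord => cSC.
  apply: (@leq_trans (\sum_(i in ~: [set i | u i < q]) q)).
    by rewrite sum_nat_const leq_mul2r; apply/orP; right; rewrite /c; lia.
  rewrite /F [leqRHS](bigID (mem (~: [set i | u i < q]))) /=.
  apply: leq_trans (leq_addr _ _); apply: leq_sum => i; rewrite !inE; lia.
(* [A] takes every index below [q] and none above, so [minn q (u i)] is [u i] on [A] and [q] off
   [A]. *)
have [||A [SA AG cA]] := @set_between _ [set i | u i < q] (~: [set i | q < u i]) h.
- by apply/fintype.subsetP => i; rewrite !inE; lia.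
- by have := cardsC [set i | q < u i]; rewrite card_ord /c in qc *; lia.
have umA := um A cA; rewrite addnC (leq_trans (leq_add umA (leqnn _))) //.
rewrite /F [leqRHS](bigID (mem A)) /= leq_add //.
  apply: leq_sum => i iA; have := fintype.subsetP AG _ iA; rewrite !inE; lia.
rewrite /c -cA -sum_notin; apply: leq_sum => i iA.
have : i \notin [set i | u i < q] by apply: contra iA => /(fintype.subsetP SA).
by rewrite inE; lia.
Qed.

(* [F] is concave: its slope at [p] is the number of exponents exceeding [p]. *)
Lemma sum_min_concave t p q : p <= q ->
  (t + 1) * p <= F p \/ F q <= F p + t * (q - p).
Proof.
move=> pq; pose G := [set i | p < u i].
(* More than [t] exponents above [p] already contribute [(t + 1) * p]; otherwise at most [t] terms
   grow between [p] and [q], each by at most [q - p]. *)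
have [tG|Gt] := ltnP t #|G|; [left|right].
  apply: (@leq_trans (\sum_(i in G) p)).
    by rewrite sum_nat_const leq_mul2r; apply/orP; right; lia.
  rewrite /F [leqRHS](bigID (mem G)) /=; apply: leq_trans (leq_addr _ _).
  apply: leq_sum => i; rewrite !inE; lia.
apply: (@leq_trans (F p + \sum_(i in G) (q - p))).
  have -> : F p + \sum_(i in G) (q - p) =
      \sum_i (minn p (u i) + (if i \in G then q - p else 0)).
    by rewrite big_split -big_mkcond.
  by apply: leq_sum => i _; rewrite inE; case: ltnP; lia.
by rewrite leq_add2l sum_nat_const leq_mul2r Gt orbT.
Qed.

End Truncation.

(** Put [W = s * q + r] with [r < q]. Concavity with slope [s + c] bounds [F x - c * x] below by the
    smaller of [(s + 1) * x] and [s * x + r] for every [x <= q]; this is used at [x = p] and at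
    [x = q - p]. *)
Lemma cut_level h (L k q c W : nat) (F : nat -> nat) :
  0 < k -> 0 < L -> (forall j, 0 < j <= h -> j %| L) ->
  F q = c * q + W -> L * k.+1 <= W -> q <= W <= h * q ->
  (forall t p, p <= q -> (t + 1) * p <= F p \/ F q <= F p + t * (q - p)) ->
  exists p, [/\ p <= q, c * p + L <= F p & c * (q - p) + L * k <= F (q - p)].
Proof.
move=> k0 L0 Ldiv Fq LW /andP[qW Wq] conc.
have q0 : 0 < q by rewrite lt0n; apply/eqP => q0; move: Wq; rewrite q0; nia.
have WE := divn_eq W q; have rq := ltn_pmod W q0.
move: (W %/ q) (W %% q) WE rq => s r WE rq.
have s0 : 0 < s by rewrite lt0n; apply/eqP => s0; move: WE; rewrite s0; nia.
have sh : s <= h by nia.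
have conc' := conc (s + c).
(* In the first case [p = L / (s + 1)]: the second condition says [p <= r], and [r > 0] with
   [W <= h * q] gives [s + 1 <= h]. *)
have [/andP[r0 Lr]|small] := boolP ((0 < r) && (L <= r * (s + 1))).
  have /Ldiv/dvdnP[p LE] : 0 < s + 1 <= h by nia.
  exists p; have pr : p <= r by nia.
  split; first lia.
    by have [||] := conc' p; nia.
  by have [||] := conc' (q - p); nia.
(* Otherwise [p = L / s]. When [r > 0], the bound [L * k <= (s + 1) * (q - p)] loses
   [r * (s + 1) / s < p], which the surplus [p * k] absorbs because [k > 0]. *)
have /Ldiv/dvdnP[p LE] : 0 < s <= h by lia.
have pq : p <= q by nia.
exists p; split=> //.
  by have [||] := conc' p; nia.
by have [||] := conc' (q - p); nia.
Qed.

End StarExponents.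

(** * Sums of exponent sets and the two divisibility bounds *)

Section Sumset.
Variable n : nat.
Implicit Types (u v : 'X_{1..n}) (C D : set 'X_{1..n}).

Definition sumset C D : set 'X_{1..n} :=
  [set u | exists b c, [/\ C b, D c & u = (b + c)%MM]].

(** Mirrors [ideal_pow]: the zeroth power is everything, the exponent set of the unit ideal. *)
Definition sumpow C m : set 'X_{1..n} := iter m (sumset C) setT.

Definition upclosed C := forall u v, C u -> C (u + v)%MM.

Lemma upclosed_sumset C D : upclosed D -> upclosed (sumset C D).
Proof.
move=> upD u v [b [c [Cb Dc ->]]]; exists b, (c + v)%MM.
by split; rewrite ?addmA //; apply: upD.
Qed.

Lemma upclosed_sumpow C m : upclosed (sumpow C m).
Proof. by elim: m => [//|m IHm]; apply: upclosed_sumset. Qed.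

Lemma upclosed_wt (A : {set 'I_n}) m : upclosed (fun u => m <= wt A u).
Proof. by move=> u v um; rewrite wtD; lia. Qed.

Lemma sumpow_wt (A : {set 'I_n}) C d m u : (forall v, C v -> d <= wt A v) ->
  sumpow C m u -> d * m <= wt A u.
Proof.
move=> Cd; elim: m u => [|m IHm] u; first by rewrite muln0.
by case=> b [c [/Cd db /IHm dc ->]]; rewrite wtD; lia.
Qed.

Lemma sumpow_starexp h d m : (sumpow (starexp h d) m `<=` starexp h (d * m))%classic.
Proof. by move=> u um A cA; apply: sumpow_wt um => v; apply. Qed.

Lemma starexp_split h L k u : 0 < h <= n -> 0 < k -> 0 < L ->
  (forall j, 0 < j <= h -> j %| L) ->
  starexp h (L * k.+1) u -> sumset (starexp h L) (starexp h (L * k)) u.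
Proof.
move=> hn k0 L0 Ldiv /(starexp_sum_min hn)[q [Fq Fq']].
pose F p := \sum_i minn p (u i).
have Fn : F q <= n * q.
  rewrite /F -[n in n * q]card_ord -sum_nat_const.
  by apply: leq_sum => i _; apply: geq_minl.
have [||||p [pq Fp Fqp]] := @cut_level h L k q (n - h) (F q - (n - h) * q) F k0 L0 Ldiv.
- by rewrite -/(F q) in Fq *; lia.
- by rewrite -/(F q) in Fq *; lia.
- by rewrite -/(F q) in Fq Fq' *; nia.
- by move=> t p; apply: sum_min_concave.
pose a i := minn q (u i).
(* [lo i] is the least part of the truncated exponent [a i] to remove so that at most [q - p] of it
   remains. The truncated remainder then sums to at least [F q - B], which suffices for either value
   of the maximum [B]. *)
pose lo i := a i - minn (q - p) (u i).
pose B := maxn (\sum_i lo i) ((n - h) * p + L).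
have loE : \sum_i lo i + F (q - p) = F q.
  by rewrite /F -big_split; apply: eq_bigr => i _ /=; rewrite /lo /a; lia.
have [||b [bP bE]] := @interpolate n lo (fun i => minn p (u i)) B.
- by move=> i; rewrite /lo /a; lia.
- rewrite leq_maxl geq_max Fp andbT leq_sum // => i _; rewrite /lo /a; lia.
exists [multinom b i | i < n]%MM, [multinom (u i - b i)%N | i < n]%MM; split.
- apply: (@sum_min_starexp _ _ _ p); first by case/andP: hn.
  rewrite (eq_bigr b) => [|i _]; last by rewrite mnmE; have := bP i; lia.
  by rewrite bE leq_maxr.
- apply: (@sum_min_starexp _ _ _ (q - p)); first by case/andP: hn.
  rewrite -(leq_add2l B); apply: (@leq_trans (F q)).
    by rewrite -/(F q) in Fq Fq' *; rewrite /B; nia.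
  rewrite -bE -big_split; apply: leq_sum => i _ /=.
  by rewrite mnmE; have := bP i; rewrite /lo /a; lia.
- by apply/mnmP => i; rewrite mnmDE !mnmE; have := bP i; lia.
Qed.

Lemma starexp_sumpow h L k : 0 < h <= n -> 0 < L ->
  (forall j, 0 < j <= h -> j %| L) -> 0 < k ->
  starexp h (L * k) = sumpow (starexp h L) k.
Proof.
move=> hn L0 Ldiv k0; apply/seteqP; split; last exact: sumpow_starexp.
(* The induction starts at [k = 1], since [starexp_split] needs a positive number of remaining
   factors. *)
elim: k k0 => [//|[|k] IHk] _ u.
  by rewrite muln1 => uL; exists u, 0%MM; rewrite addm0.
by case/starexp_split=> // b [c [bL cL ->]]; exists b, c; split=> //; apply: IHk.
Qed.

Lemma sumpow_dvd h j d : 0 < j <= h -> h < n ->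
  (starexp h (d * j) `<=` sumpow (@starexp n h d) j)%classic -> j %| d.
Proof.
move=> /andP[j0 jh] hn sub.
have [S [_ _ cS]] : exists S : {set 'I_n},
    [/\ finset.set0 \subset S, S \subset [set: 'I_n] & #|S| = n - h + j].
  by apply: set_between; rewrite ?finset.sub0set // cards0 cardsT card_ord; lia.
have cSC : #|~: S| = h - j by have := cardsC S; rewrite card_ord; lia.
pose u := [multinom (if i \in S then d else 0)%N | i < n]%MM.
have wtS (A : {set 'I_n}) v : (forall i, i \notin S -> v i = 0) ->
    wt A v = \sum_(i in A :&: S) v i.
  move=> v0; rewrite /wt (bigID (mem S)) /= [X in _ + X]big1 ?addn0.
    by apply: eq_bigl => i; rewrite inE.
  by move=> i /andP[_ /v0].
have wtu (A : {set 'I_n}) : wt A u = d * #|A :&: S|.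
  rewrite wtS => [|i iS]; last by rewrite mnmE (negPf iS).
  rewrite mulnC -sum_nat_const; apply: eq_bigr => i.
  by rewrite inE mnmE => /andP[_ ->].
have cAS (A : {set 'I_n}) : #|A| = #|A :&: S| + #|A :\: S|.
  by rewrite cardsID.
(* At most [h - j] indices of [A] lie outside [S], so at least [j] lie inside. *)
have /sub : starexp h (d * j) u.
  move=> A cA; rewrite wtu leq_mul2l; apply/orP; right.
  have := cAS A; suff : #|A :\: S| <= h - j by lia.
  by rewrite -cSC subset_leq_card // finset.setDE finset.subsetIr.
case: j j0 jh cS cSC {sub} => [//|j] _ jh cS cSC [b [c [bd cd uE]]].
have bS i : i \notin S -> b i = 0.
  by move=> iS; have /mnmP/(_ i) := uE; rewrite mnmDE mnmE (negPf iS); lia.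
(* On an [h]-set containing the complement of [S], the weight of [u] is exactly [d * j.+1], the sum
   of the lower bounds for [b] and [c], so both bounds are attained. *)
have wtb (A : {set 'I_n}) : ~: S \subset A -> #|A| = h ->
    #|A :&: S| = j.+1 /\ wt A b = d.
  move=> SA cA; have cASj : #|A :&: S| = j.+1.
    have := cAS A; rewrite finset.setDE (finset.setIidPr SA); lia.
  split=> //; have := sumpow_wt (fun v vd => vd A cA) cd.
  have : wt A u = wt A b + wt A c by rewrite uE wtD.
  by have := bd A cA; rewrite wtu cASj; lia.
(* Exchanging [x] for [y] in such a set preserves the weight of [b]; [h < n] leaves room to avoid
   [y]. *)
have bconst x y : x \in S -> y \in S -> b x = b y.
  move=> xS yS; have [->//|xy] := eqVneq x y.
  have [||A [SA AS cA]] := @set_between _ (x |: ~: S) (~: [set y]%SET) h.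
  - by rewrite finset.subUset finset.sub1set !inE xy finset.setCS finset.sub1set.
  - rewrite finset.cardsU1 inE xS cSC.
    by have := cardsC [set y]%SET; rewrite cards1 card_ord; lia.
  have xA : x \in A by apply: (fintype.subsetP SA); rewrite !inE eqxx.
  have yA : y \notin A.
    by apply/negP => /(fintype.subsetP AS); rewrite !inE eqxx.
  have SA' : ~: S \subset A by apply: (fintype.subset_trans _ SA); apply: finset.subsetUr.
  have [_ wA] := wtb _ SA' cA.
  have [||_ wA'] := wtb (y |: A :\ x).
  - apply/fintype.subsetP => i iS; rewrite !inE (fintype.subsetP SA' _ iS) andbT.
    by apply/orP; right; apply: contraTneq iS => ->; rewrite inE xS.
  - rewrite finset.cardsU1 !inE (negPf yA) andbF /= -cA (cardsD1 x A) xA.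
    by [].
  move: wA'; rewrite -wA /wt big_setU1 ?inE ?(negPf yA) ?andbF //=.
  by rewrite (big_setD1 x xA) /= => /addIn ->.
have [x xS] : exists x, x \in S by apply/card_gt0P; rewrite cS; lia.
have [||A [SA _ cA]] := @set_between _ (~: S) [set: 'I_n] h.
- by rewrite finset.subsetT.
- by rewrite cSC cardsT card_ord; lia.
have [cASj <-] := wtb A SA cA.
rewrite wtS // (eq_bigr (fun _ => b x)) => [|i]; last first.
  by rewrite inE => /andP[_ iS]; apply: bconst.
by rewrite sum_nat_const cASj dvdn_mulr.
Qed.

End Sumset.

(** * Closure of generated ideals *)

Section IdealGen.
Variables (S : comNzRingType) (A : set S).
Local Open Scope ring_scope.
Local Open Scope classical_set_scope.

Lemma ideal_gen_add G x y :
  ideal_gen A G x -> ideal_gen A G y -> ideal_gen A G (x + y).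
Proof.
by move=> Gx Gy J [JA GJ]; have [_ _ + _] := JA; apply; [apply: Gx|apply: Gy].
Qed.

Lemma ideal_gen_mul G a x : A a -> ideal_gen A G x -> ideal_gen A G (a * x).
Proof. by move=> Aa Gx J [JA GJ]; have [_ _ _] := JA; apply=> //; apply: Gx. Qed.

Lemma ideal_gen0 G : ideal_gen A G 0.
Proof. by move=> J [[]]. Qed.

End IdealGen.

(** * Monomial ideals as sets of exponents *)

Section Monomial.
Variables (k : fieldType) (n : nat).
Local Open Scope ring_scope.
Local Open Scope classical_set_scope.
Implicit Types (f g : {mpoly k[n]}) (C D : set 'X_{1..n}) (A : {set 'I_n}).

(** For an upward closed [C] this is a monomial ideal, from which [monset_inj] recovers [C]. *)
Definition monset C : set {mpoly k[n]} := [set f | forall u, u \in msupp f -> C u].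

Lemma monset0 C : monset C 0.
Proof. by move=> u; rewrite msupp0. Qed.

Lemma monsetD C f g : monset C f -> monset C g -> monset C (f + g).
Proof. by move=> Cf Cg u /msuppD_le; rewrite mem_cat => /orP[/Cf|/Cg]. Qed.

Lemma monsetB C f g : monset C f -> monset C g -> monset C (f - g).
Proof. by move=> Cf Cg u /msuppB_le; rewrite mem_cat => /orP[/Cf|/Cg]. Qed.

Lemma monsetM C D f g : monset C f -> monset D g -> monset (sumset C D) (f * g).
Proof.
move=> Cf Dg u /msuppM_le/allpairsP[[b c] [/= /Cf Cb /Dg Dc ->]].
by exists b, c.
Qed.

Lemma monsetX C u : monset C 'X_[u] <-> C u.
Proof.
split=> [|Cu v]; first by apply; rewrite msuppX inE.
by rewrite msuppX inE => /eqP ->.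
Qed.

Lemma monset_inj C D : monset C = monset D -> C = D.
Proof.
by move=> CD; apply/seteqP; split=> u; rewrite -!monsetX CD.
Qed.

Lemma monsetS C D : C `<=` D -> monset C `<=` monset D.
Proof. by move=> CD f Cf u /Cf /CD. Qed.

Lemma monset_setT : monset setT = setT.
Proof. by apply/seteqP; split. Qed.

Lemma monset_ideal C : upclosed C -> ideal_of setT (monset C).
Proof.
move=> upC; split=> //; [exact: monset0|exact: monsetD|move=> a f _ Cf].
rewrite mulrC => u /(monsetM Cf (D := setT) (g := a))[//|b [c [Cb _ ->]]].
exact: upC.
Qed.

Lemma monset_ideal_gen C G : (forall u, C u -> ideal_gen setT G 'X_[u]) ->
  monset C `<=` ideal_gen setT G.
Proof.
move=> CG f Cf; rewrite [f]mpolyE big_seq.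
elim/big_ind: _ => [||u uf]; [exact: ideal_gen0|exact: ideal_gen_add|].
rewrite -mul_mpolyC; apply: ideal_gen_mul => //.
by apply: CG; apply: Cf.
Qed.

Lemma ideal_mul_monset C D : upclosed D ->
  ideal_mul (monset C) (monset D) = monset (sumset C D).
Proof.
move=> upD; apply/seteqP; split.
  apply: smallest_sub; first exact/monset_ideal/upclosed_sumset.
  by move=> _ [f [g [Cf Dg ->]]]; apply: monsetM.
apply: monset_ideal_gen => _ [b [c [Cb Dc ->]]]; apply: sub_gen_smallest.
by exists 'X_[b], 'X_[c]; split; rewrite ?monsetX // mpolyXD.
Qed.

Lemma ideal_pow_monset C m : ideal_pow (monset C) m = monset (sumpow C m).
Proof.
elim: m => [|m IHm]; first by rewrite /sumpow /= monset_setT.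
rewrite /ideal_pow iterS -/(ideal_pow _ _) IHm ideal_mul_monset //.
exact: upclosed_sumpow.
Qed.

Lemma wt_gt0 A (u : 'X_{1..n}) : (0 < wt A u)%N -> exists2 i, i \in A & (0 < u i)%N.
Proof.
rewrite lt0n sum_nat_eq0 negb_forall => /existsP[i].
by rewrite negb_imply -lt0n => /andP[]; exists i.
Qed.

Lemma wt_mnm1 A i : wt A U_(i)%MM = (i \in A).
Proof.
rewrite /wt; have [iA|iA] := boolP (i \in A).
  rewrite (big_setD1 i iA) /= mnm1E eqxx big1 // => j.
  by rewrite !inE mnm1E eq_sym => /andP[/negPf ->].
by rewrite big1 // => j jA; rewrite mnm1E; case: eqP iA => // ->; rewrite jA.
Qed.

Lemma var_ideal_monset A :
  ideal_gen setT [set 'X_i | i in [set i | i \in A]] =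
  monset (fun u => (1 <= wt A u)%N).
Proof.
apply/seteqP; split.
  apply: smallest_sub; first exact/monset_ideal/upclosed_wt.
  by move=> _ [i iA <-]; rewrite monsetX wt_mnm1 iA.
apply: monset_ideal_gen => u /wt_gt0[i iA ui].
have -> : u = (u - U_(i) + U_(i))%MM.
  rewrite submK //; apply/mnm_lepP => j; rewrite mnm1E.
  by case: eqP => [<-|].
rewrite mpolyXD; apply: ideal_gen_mul => //; apply: sub_gen_smallest.
by exists i.
Qed.

Lemma star_ideal_monset h : @star_ideal k n h = monset (starexp h 1).
Proof.
apply/seteqP; split=> [f If u uf A cA|f If A cA].
  by have := If A cA; rewrite var_ideal_monset; apply.
by rewrite var_ideal_monset => u /If; apply.
Qed.

(* If [f] has order [d < m] for the [A]-grading and [g] has order 0, then the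
   product of their initial forms is nonzero, and it is the degree [d] part of
   [g * f]. *)
Lemma monset_wt_primary A m f g :
  ~ monset (fun u => (1 <= wt A u)%N) g ->
  monset (fun u => (m <= wt A u)%N) (g * f) ->
  monset (fun u => (m <= wt A u)%N) f.
Proof.
move=> g1 gfm u0 u0f; rewrite leqNgt; apply/negP => u0m.
have exd : exists d, has (fun u => wt A u == d) (msupp f).
  by exists (wt A u0); apply/hasP; exists u0.
case: (ex_minnP exd) => d /hasP[u1 u1f /eqP u1d] dmin.
have dm : (d < m)%N.
  by apply: leq_ltn_trans u0m; apply: dmin; apply/hasP; exists u0.
have fd : monset (fun u => (d <= wt A u)%N) f.
  by move=> u uf; apply: dmin; apply/hasP; exists u.
pose part e p : {mpoly k[n]} :=
  \sum_(u <- msupp p | wt A u == e) p@_u *: 'X_[u].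
have partE e p u : (part e p)@_u = if wt A u == e then p@_u else 0.
  rewrite /part raddf_sum /=.
  under eq_bigr => v _ do rewrite mcoeffZ mcoeffX.
  case: ifP => ue; last first.
    rewrite big1 // => v ve; case: eqP => [vu|_]; last by rewrite mulr0.
    by rewrite -vu ve in ue.
  have [us|us] := boolP (u \in msupp p).
    rewrite (big_rem u us) /= ue eqxx mulr1 big_seq_cond big1 ?addr0 // => v.
    rewrite mem_rem_uniq ?msupp_uniq // inE => /andP[/andP[/negPf /= -> _] _].
    by rewrite mulr0.
  rewrite -mcoeff_eq0 in us; rewrite (eqP us) big_seq_cond big1 // => v /andP[vs _].
  by case: eqP => [vu|]; rewrite ?mulr0 // vu (eqP us) mul0r.
have part_hom e p : monset (fun u => wt A u = e) (part e p).
  by move=> u; rewrite mcoeff_msupp partE; case: ifP => [/eqP //|_]; rewrite eqxx.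
have part_low e p : monset (fun u => (e <= wt A u)%N) p ->
    monset (fun u => (e < wt A u)%N) (p - part e p).
  move=> pe u; rewrite mcoeff_msupp mcoeffB partE.
  case: ifP => [_|ue]; first by rewrite subrr eqxx.
  by rewrite subr0 -mcoeff_msupp => /pe; rewrite leq_eqVlt eq_sym ue.
have f0 : part d f != 0.
  apply/eqP => /mpolyP/(_ u1); rewrite partE u1d eqxx mcoeff0 => /eqP.
  by rewrite mcoeff_eq0 u1f.
have g0 : part 0%N g != 0.
  apply/eqP => /mpolyP g0; apply: g1 => u; rewrite mcoeff_msupp lt0n.
  by have := g0 u; rewrite partE mcoeff0; case: ifP => // _ ->; rewrite eqxx.
have subadd a b (u : 'X_{1..n}) :
    sumset (fun u => (a <= wt A u)%N) (fun u => (b <= wt A u)%N) u ->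
    (a + b <= wt A u)%N.
  by case=> v [w [va wb ->]]; rewrite wtD; lia.
(* Removing a lowest part raises the weight, so up to terms of weight above [d] this product agrees
   with [g * f], whose weights are at least [m > d]. *)
have low : monset (fun u => (d < wt A u)%N) (part 0%N g * part d f).
  have -> : part 0%N g * part d f =
      g * f - (part 0%N g * (f - part d f) + (g - part 0%N g) * f).
    by ring.
  apply: monsetB; first by move=> u /gfm; apply: leq_trans.
  apply: monsetD.
    move=> u /(monsetM (C := setT) _ (part_low _ _ fd))[//|v [w [_ dw ->]]].
    by rewrite wtD; lia.
  have gl : monset (fun u => (1 <= wt A u)%N) (g - part 0%N g) by apply: part_low.
  by move=> u /(monsetM gl fd)/subadd; rewrite add1n.
have : part 0%N g * part d f != 0 by rewrite mulf_neq0.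
rewrite -msupp_eq0; case E : (msupp _) => [//|u s] _.
have us : u \in msupp (part 0%N g * part d f) by rewrite E inE eqxx.
have := low _ us; have [b [c [b0 cd ->]]] := monsetM (part_hom _ _) (part_hom _ _) us.
by rewrite wtD b0 cd ltnn.
Qed.

End Monomial.

(** * Localization, associated primes and symbolic powers *)

Section SymbolicPower.
Local Open Scope ring_scope.
Local Open Scope classical_set_scope.

Lemma prime_idealP (R : comNzRingType) (p : set R) :
  prime_ideal p <-> [/\ ideal_of setT p, ~ p 1 &
    forall a b, p (a * b) -> p a \/ p b].
Proof.
split=> [[[p0 p1 pD] pM]|[[_ p0 pD pM] p1 pP]].
  have {}pD a u v : p u -> p v -> p (a * u + v).
    by move=> pu pv; apply: set_mem; apply: pD; apply: mem_set.
  have {}p0 : p 0 by apply: set_mem.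
  split=> [|/mem_set p1'|a b /mem_set /pM /orP[]/set_mem];
    [|by rewrite p1' in p1|by left|by right].
  split=> // [x y px|a x _ px]; first by rewrite -[x]mul1r; apply: pD.
  by rewrite -[_ * _]addr0; apply: pD.
split; last first.
  by move=> a b /set_mem /pP[] /mem_set ->; rewrite ?orbT.
split; [exact: mem_set|by apply/negP => /set_mem|].
by move=> a u v /set_mem pu /set_mem pv; apply/mem_set/pD => //; apply: pM.
Qed.

Lemma sub_ideal_ext (R : idomainType) (p J : set R) s f :
  p 0 -> ~ p s -> J (s * f) -> ideal_ext p J (tofrac f).
Proof.
move=> p0 ps Jsf; have s0 : tofrac s != 0.
  by rewrite tofrac_eq0; apply: contra_notN ps => /eqP ->.
rewrite -[tofrac f](mulKf s0) -tofracM; apply: ideal_gen_mul.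
  by exists 1, s; rewrite tofrac1 mul1r.
by apply: sub_gen_smallest; exists (s * f).
Qed.

(** Since [W] is saturated at [p], the fractions with numerator in [W] form an ideal of the
    localization that contains the extension of [J] and contracts into [W]. *)
Lemma ideal_ext_primary (R : idomainType) (p J W : set R) :
  prime_ideal p -> ideal_of setT W -> (forall s f, ~ p s -> W (s * f) -> W f) ->
  J `<=` W -> @tofrac R @^-1` ideal_ext p J `<=` W.
Proof.
move=> /prime_idealP[[_ p0 _ _] p1 pP] [_ W0 WD WM] Wp JW.
have nz s : ~ p s -> tofrac s != 0.
  by move=> ps; rewrite tofrac_eq0; apply: contra_notN ps => /eqP ->.
have pM s t : ~ p s -> ~ p t -> ~ p (s * t) by move=> ps pt /pP[].
pose K := [set q | exists j s, [/\ W j, ~ p s & q = tofrac j / tofrac s]].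
have KJ : ideal_ext p J `<=` K.
  apply: smallest_sub; last first.
    by move=> _ [j Jj <-]; exists j, 1; rewrite tofrac1 divr1; split=> //; apply: JW.
  split.
  - by move=> _ [j [s [_ ps ->]]]; exists j, s.
  - by exists 0, 1; rewrite tofrac0 mul0r.
  - move=> _ _ [i [s [Wi ps ->]]] [j [t [Wj pt ->]]].
    exists (t * i + s * j), (s * t); split; [by apply: WD; apply: WM|exact: pM|].
    by rewrite addf_div ?nz // tofracD !tofracM
      ![tofrac t * _]mulrC [tofrac s * tofrac j]mulrC.
  - move=> _ _ [a [s [ps ->]]] [j [t [Wj pt ->]]].
    exists (a * j), (s * t); split; [exact: WM|exact: pM|].
    by rewrite !tofracM mulf_div.
move=> f /KJ[j [s [Wj ps /(canLR (divfK (nz _ ps)))]]].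
move=> /eqP; rewrite -tofracM tofrac_eq mulrC => /eqP jE.
by apply: (Wp s) => //; rewrite jE.
Qed.

Variables (k : fieldType) (n : nat).
Implicit Types (A B : {set 'I_n}).

Definition var_ideal A : set {mpoly k[n]} := monset (fun u => (1 <= wt A u)%N).

Definition mnm_set A : 'X_{1..n} := [multinom (i \in A : nat) | i < n].

Lemma wt_mnm_set A B : wt A (mnm_set B) = #|A :&: B|.
Proof.
rewrite /wt -sum1_card big_mkcond [RHS]big_mkcond; apply: eq_bigr => i _.
by rewrite mnmE inE; case: (i \in A); case: (i \in B).
Qed.

Lemma card_setIC_gt0 A B : #|A| = #|B| -> (0 < #|B :&: ~: A|)%N = (A != B).
Proof.
move=> cAB; rewrite card_gt0 -finset.setDE finset.setD_eq0.
by rewrite [A == B]eq_sym eqEcard cAB leqnn andbT.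
Qed.

Lemma prime_var_ideal A : prime_ideal (var_ideal A).
Proof.
apply/prime_idealP; split; first exact/monset_ideal/upclosed_wt.
  by rewrite -mpolyX0 /var_ideal monsetX /wt big1 // => i _; rewrite mnm0E.
move=> f g Pfg; have [Pf|nPf] := pselect (var_ideal A f); [by left|right].
exact: monset_wt_primary nPf Pfg.
Qed.

(** The witness is the product of the variables outside [A]: it lies in the prime of every other
    [h]-set but not in that of [A], so its class has the prime of [A] as annihilator. *)
Lemma Ass_star_ideal h A : #|A| = h -> Ass (@star_ideal k n h) (var_ideal A).
Proof.
move=> cA; split; first exact: prime_var_ideal.
exists 'X_[mnm_set (~: A)%SET]; rewrite star_ideal_monset.
apply/seteqP; split=> f /= Pf u.
  rewrite (perm_mem (msuppMX _ _)) => /mapP[v /Pf vA ->] B cB; rewrite wtD wt_mnm_set.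
  have [<-|] := eqVneq A B; first by rewrite (leq_trans vA) ?leq_addl.
  by rewrite -card_setIC_gt0 ?cA ?cB //; lia.
move=> uf; have uf' : (mnm_set (~: A) + u)%MM \in msupp (f * 'X_[mnm_set (~: A)]).
  by rewrite (perm_mem (msuppMX _ _)); apply/mapP; exists u; rewrite // addmC.
have := Pf _ uf' _ cA.
by rewrite wtD wt_mnm_set finset.setICr cards0.
Qed.

(** For [i] in [A], the variable ['X_i] times the product of the variables outside [A] lies in the
    star ideal; each of the [m] factors is such a product, the last one taking what is left of
    [u]. *)
Lemma sumpow_mnm_set h A m u : #|A| = h -> (m <= wt A u)%N ->
  sumpow (starexp h 1) m (u + mnm_set (~: A)%SET *+ m)%MM.
Proof.
move=> cA; elim: m u => [//|m IHm] u mu.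
have [i iA ui] : exists2 i, i \in A & (0 < u i)%N by apply: wt_gt0; lia.
have uE : u = (U_(i) + (u - U_(i)))%MM.
  rewrite addmC submK //; apply/mnm_lepP => j; rewrite mnm1E.
  by case: eqP => [<-|].
exists (U_(i) + mnm_set (~: A)%SET)%MM, (u - U_(i) + mnm_set (~: A)%SET *+ m)%MM; split.
- move=> B cB; rewrite wtD wt_mnm1 wt_mnm_set.
  have [<-|] := eqVneq A B; first by rewrite iA.
  by rewrite -card_setIC_gt0 ?cA ?cB //; lia.
- by apply: IHm; move: mu; rewrite {1}uE wtD wt_mnm1 iA.
- by rewrite {1}uE mulmS; apply/mnmP => j; rewrite !mnmDE; lia.
Qed.

(** Locally at the prime of [A] the star ideal becomes that prime, whose powers are primary and cut
    out by the weight on [A]. *)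
Lemma symbolic_pow_star h m :
  symbolic_pow (@star_ideal k n h) m = monset (starexp h m).
Proof.
apply/seteqP; split=> [f Ef u uf A cA|f Ef p [/prime_idealP pp [a pE]]].
  suff : monset (fun u => (m <= wt A u)%N) f by apply.
  have /ideal_ext_primary : prime_ideal (var_ideal A) by apply: prime_var_ideal.
  apply; last by apply: Ef; apply: Ass_star_ideal cA.
  - exact/monset_ideal/upclosed_wt.
  - by move=> s g; apply: monset_wt_primary.
  rewrite star_ideal_monset ideal_pow_monset; apply: monsetS => v vm.
  by rewrite -[m]mul1n; apply: sumpow_wt vm => w; apply.
have [[_ p0 _ _] p1 _] := pp.
(* Since [1] is not in [p], the element [a] avoids the prime of some [A], which therefore contains
   [p]. *)
have [A cA nPa] : exists2 A : {set 'I_n}, #|A| = h & ~ var_ideal A a.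
  apply: contrapT => nA; apply: p1; rewrite pE /= mul1r star_ideal_monset.
  move=> u ua A cA; apply: contrapT => nu; apply: nA.
  by exists A => // /(_ u ua).
have pA : p `<=` var_ideal A.
  move=> r; rewrite pE /= star_ideal_monset => ra; apply: monset_wt_primary nPa _.
  by rewrite mulrC => u /ra; apply.
(* This monomial lies outside the prime of [A], hence outside [p], and it carries [f] into the
   [m]-th power. *)
apply: (@sub_ideal_ext _ _ _ 'X_[mnm_set (~: A)%SET *+ m]) => //.
  move=> /pA; rewrite /var_ideal monsetX => /wt_gt0[i iA].
  by rewrite mulmnE mnmE inE iA.
rewrite star_ideal_monset ideal_pow_monset mulrC => u.
rewrite (perm_mem (msuppMX _ _)) => /mapP[v /Ef vm ->].
by rewrite addmC; apply: (sumpow_mnm_set cA (vm _ cA)).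
Qed.

End SymbolicPower.

(** * The least common multiple and the conclusion *)

Lemma dvdn_lcm_range h j : 0 < j <= h -> j %| \big[lcmn/1]_(1 <= i < h.+1) i.
Proof.
by move=> jh; rewrite (big_rem j) ?mem_index_iota //= dvdn_lcml.
Qed.

Lemma lcm_range_dvdn h d :
  (forall j, 0 < j <= h -> j %| d) -> \big[lcmn/1]_(1 <= i < h.+1) i %| d.
Proof.
move=> jd; rewrite big_nat; elim/big_ind: _ => [|x y xd yd|j /jd //].
  exact: dvd1n.
by rewrite dvdn_lcm xd yd.
Qed.

Lemma lcm_range_gt0 h : 0 < \big[lcmn/1]_(1 <= i < h.+1) i.
Proof.
rewrite big_nat; elim/big_ind: _ => [//|x y x0 y0|j /andP[] //].
by rewrite lcmn_gt0 x0.
Qed.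

Lemma svd_set_star (k : fieldType) (n h d : nat) :
  svd_set (@star_ideal k n h) d <-> 0 < d /\
    forall m, 0 < m -> starexp h (d * m) = sumpow (@starexp n h d) m.
Proof.
split=> -[d0 dP]; split=> // m m0; have := dP m m0.
  by rewrite !symbolic_pow_star ideal_pow_monset; apply: monset_inj.
by rewrite !symbolic_pow_star ideal_pow_monset => ->.
Qed.

Theorem theorem3p6 (k : fieldType) (n h : nat) (h_ge1 : (1 <= h)%N)
    (h_ltn : (h < n)%N) :
  svd (@star_ideal k n h) = Some (\big[lcmn/1%N]_(1 <= i < h.+1) i).
Proof.
set L := \big[_/_]_(_ <= _ < _) _.
have L_svd : svd_set (@star_ideal k n h) L.
  apply/svd_set_star; split=> [|m m0]; first exact: lcm_range_gt0.
  apply: starexp_sumpow; rewrite ?h_ge1 ?(ltnW h_ltn) ?lcm_range_gt0 //.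
  exact: dvdn_lcm_range.
rewrite /svd; case: pselect => [exd|[]]; last by exists L.
case: ex_minnP => d /asboolP/svd_set_star[d0 dP] dmin.
(* Minimality gives [d <= L]; conversely [L] divides [d], since every [j] from 1 to [h] does. *)
congr Some; apply/eqP; rewrite eqn_leq dmin ?asboolT //=.
apply: dvdn_leq => //; apply: lcm_range_dvdn => j jh.
apply: (@sumpow_dvd n h) => //; rewrite dP //.
by case/andP: jh.
Qed.
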